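(* Let $0<p<q$. There is a constant $C_{p,q}\in(0,1]$ depending only on $p$ and $q$ such that the following holds. For any $n$, any agents $N=\{1,\dots,n\}$ whose utility distributions $\mathcal{D}_1,\dots,\mathcal{D}_n$ on $[0,1]$ are $(p,q)$-PDF-bounded and have interval support, and any multipliers $\vec\beta\in\mathbb{R}_{>0}^n$ such that $|p_i(\vec\beta)-1/n|<1/(2n)$ for all $i\in N$, it holds for all $i\ne j\in N$ that $$\mathbb{E}\left[u_i\,\Big|\,\beta_i u_i=\max_{k\in N}\beta_k u_k\right]-\mathbb{E}\left[u_i\,\Big|\,\beta_j u_j=\max_{k\in N}\beta_k u_k\right]\ge C_{p,q}.$$
   Context: Here $u_1,\dots,u_n$ are independent random variables with $u_k\sim\mathcal{D}_k$, and $p_i(\vec\beta)=\mathbb{P}\left[\beta_i u_i=\max_{k\in N}\beta_k u_k\right]$. Interval support: the support of $\mathcal{D}_i$ is an interval $[a_i,b_i]$ with $0\le a_i<b_i\le 1$. $(p,q)$-PDF-bounded: $\mathcal{D}_i$ has a probability density function that lies between $p$ and $q$ on the support of $\mathcal{D}_i$. *)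

(* Defs.v *)
(* MathComp / MathComp-Analysis *)
From HB Require Import structures.
From mathcomp Require Import all_boot all_order all_algebra.
From mathcomp Require Import all_classical all_reals all_analysis.

Set Implicit Arguments.
Unset Strict Implicit.
Unset Printing Implicit Defensive.

Import Order.TTheory GRing.Theory Num.Theory.
Import numFieldNormedType.Exports.

Local Open Scope classical_set_scope.
Local Open Scope ring_scope.

Section Distribution.
Context {R : realType}.
Implicit Types (mu : probability (measurableTypeR R) R) (p q : R).

(* Topological support: the points all of whose open neighborhoods have
   positive mass. *)
Definition msupport mu : set R :=
  [set x | forall U : set R, open U -> U x -> (0 < mu U)%E].

Definition interval_support mu : Prop :=
  exists a b : R, [/\ 0 <= a, a < b, b <= 1 & msupport mu = `[a, b]%classic].

Definition is_density mu (f : R -> R) : Prop :=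
  [/\ measurable_fun setT f, forall x, 0 <= f x &
      forall A : set (measurableTypeR R), measurable A ->
        mu A = (\int[lebesgue_measure]_(x in A) (f x)%:E)%E].

(* Densities are only determined up to null sets: it is enough that one
   version of the density satisfies the bounds at every point of the support. *)
Definition pdf_bounded p q mu : Prop :=
  exists f : R -> R,
    is_density mu f /\ forall x, msupport mu x -> p <= f x <= q.

End Distribution.

Section RandomVariables.
Context {R : realType} {d : measure_display} {T : measurableType d}
  {P : probability T R}.

Definition has_law (X : {RV P >-> R}) (mu : probability (measurableTypeR R) R) :
    Prop :=
  forall A : set (measurableTypeR R), measurable A -> distribution P X A = mu A.

Definition mutually_independent (n : nat) (u : 'I_n -> {RV P >-> R}) : Prop :=
  forall (J : {set 'I_n}) (B : 'I_n -> set (measurableTypeR R)),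
    (forall k, measurable (B k)) ->
    P (\bigcap_(k in [set` J]) (u k @^-1` B k)) =
    (\prod_(k in J) P (u k @^-1` B k))%E.

(* The maximum is taken in \bar R, where -oo is neutral. *)
Definition max_event (n : nat) (u : 'I_n -> {RV P >-> R}) (beta : 'I_n -> R)
    (i : 'I_n) : set T :=
  [set w | (beta i * u i w)%:E =
           \big[maxe/-oo%E]_(k < n) (beta k * u k w)%:E].

Definition max_prob (n : nat) (u : 'I_n -> {RV P >-> R}) (beta : 'I_n -> R)
    (i : 'I_n) : R :=
  fine (P (max_event u beta i)).

(* Conditional expectation E[X | A] given an event A; meaningful when
   P A > 0 and X is integrable on A. *)
Definition cond_expectation (X : {RV P >-> R}) (A : set T) : R :=
  (\int[P]_(w in A) X w) / fine (P A).

End RandomVariables.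

(* Main.v *)
(** Write [X_k = beta_k u_k] and [G x = P (X_k <= beta_i x for all k <> i)].  By
   independence, [E[u_i | i wins] - E u_i = Cov (u_i, G u_i) / P (i wins)], and
   [E[u_i | j wins] - E u_i] is likewise a multiple of the covariance of [u_i] with
   a nonincreasing function of [u_i], hence nonpositive.  It remains to bound
   [Cov (u_i, G u_i)] below by a multiple of [P (i wins)].  The winning
   probabilities differ by a factor less than 3, which forces [beta_k < 4 q beta_i]:
   otherwise replacing a low value of [u_k] by a typical one would make [k] win too
   often.  Let [a_i] be the left end of the support, [s = a_i + 1/(8q)] and
   [t = a_i + 1/(4q)].  As [P (i wins) < 3/4 <= P (u_i > t)], some competitor [k] has
   support reaching beyond [beta_i t]; its cdf, a factor of the product [G], grows by
   a fixed ratio between [beta_i s] and [beta_i t], hence so does [G], while [u_i] has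
   mass bounded below on either side of [[s, t]]. *)

Require Import Defs.
From HB Require Import structures.
From mathcomp Require Import all_boot all_order all_algebra.
From mathcomp Require Import all_classical all_reals all_analysis.
From mathcomp Require Import measurable_realfun ring lra.

Set Implicit Arguments.
Unset Strict Implicit.
Unset Printing Implicit Defensive.

Import Order.TTheory GRing.Theory Num.Theory.
Import numFieldNormedType.Exports.

Local Open Scope classical_set_scope.
Local Open Scope ring_scope.

(** * Distribution functions of laws with bounded density on an interval *)

Section Laws.
Context {R : realType}.
Implicit Types (mu : probability (measurableTypeR R) R) (p q a b x y : R).

(** A point outside the support has a null neighborhood, hence lies in a null open interval with
    rational endpoints. [F] enumerates these intervals, and a countable union of null sets is
    null. *)
Lemma msupport_compl0 mu : measurable (msupport mu) -> mu (~` msupport mu) = 0%E.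
Proof.
move=> mS; apply: measure_negligible; first exact: measurableC.
pose F n : set (measurableTypeR R) := if @unpickle (rat * rat)%type n is Some r then
  if mu `]ratr r.1, ratr r.2[%classic == 0%E then `]ratr r.1, ratr r.2[%classic
  else set0 else set0.
apply: (@negligibleS _ _ _ _ (\bigcup_n F n)); last first.
  apply: negligible_bigcup => n; rewrite /F.
  case: unpickle => [r|]; last exact: negligible_set0.
  case: ifPn => [/eqP r0|_]; last exact: negligible_set0.
  by apply/negligibleP => //; exact: measurable_itv.
move=> x /= /existsNP[U /not_implyP[oU /not_implyP[Ux /negP U0]]].
have /nbhs_ballP[e /= e0 exU] : nbhs x U by exact: open_nbhs_nbhs.
have [r1 /[!in_itv]/= /andP[r1l r1r]] : exists r : rat, ratr r \in `]x - e, x[.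
  by apply: rat_in_itvoo; rewrite ltrBlDr ltrDl.
have [r2 /[!in_itv]/= /andP[r2l r2r]] : exists r : rat, ratr r \in `]x, x + e[.
  by apply: rat_in_itvoo; rewrite ltrDl.
have F12 : F (pickle (r1, r2)) = `]ratr r1, ratr r2[%classic.
  rewrite /F pickleK; case: ifPn => // /eqP[].
  apply: (subset_measure0 (B := (U : set (measurableTypeR R)))); [exact: measurable_itv|exact: open_measurable| |].
  - apply: subset_trans exU; rewrite ball_itv; apply: subset_itv.
    + by rewrite bnd_simp; exact: ltW.
    + by rewrite bnd_simp; exact: ltW.
  - by apply/eqP; rewrite eq_le measure_ge0 andbT leNgt.
exists (pickle (r1, r2)); first exact: I.
by rewrite F12 /= in_itv /= r1r r2l.
Qed.

Definition law_cdf mu x : R := fine (mu `]-oo, x]%classic).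

(** The interface through which the rest of the proof uses the laws: densities and topological
    supports no longer appear after it. *)
Definition cdf_slope p q a b (F : R -> R) : Prop :=
  [/\ 0 <= a, b <= 1, (forall x, x <= a -> F x = 0), (forall x, b <= x -> F x = 1)
    & forall x y, a <= x -> x <= y -> y <= b ->
        p * (y - x) <= F y - F x <= q * (y - x)].

Lemma law_cdf_diff mu x y : x <= y ->
  law_cdf mu y - law_cdf mu x = fine (mu `]x, y]%classic).
Proof.
move=> xy; rewrite /law_cdf.
have -> : (`]-oo, y] : set R)%classic = `]-oo, x] `|` `]x, y].
  by rewrite -itv_bndbnd_setU.
rewrite measureU //.
  by rewrite fineD ?fin_num_measure //; lra.
by apply/seteqP; split => z //=; rewrite !in_itv /= => -[zx /andP[]]; lra.
Qed.

(** Inside the support the density bounds are integrated over []x, y]]; outside it there is no mass,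
    by [msupport_compl0]. *)
Lemma pdf_bounded_cdf_slope p q mu : 0 < p -> pdf_bounded p q mu -> interval_support mu ->
  exists a b, cdf_slope p q a b (law_cdf mu).
Proof.
move=> p0 [f [[mf f0 fE] fpq]] [a [b [a0 ab b1 Sab]]]; exists a, b.
have mab : measurable (`[a, b]%classic : set (measurableTypeR R)) by exact: measurable_itv.
have Nab : mu (~` `[a, b]%classic) = 0%E by rewrite -Sab msupport_compl0 // Sab.
have mI (i : interval R) : measurable ([set` i] : set (measurableTypeR R)).
  exact: measurable_itv.
have mEf A : measurable_fun A (fun x => (f x)%:E).
  by apply/measurable_EFinP; apply: measurable_funTS.
split => //.
- move=> x xa; rewrite /law_cdf.
  have : mu `]-oo, x[%classic = 0%E.
    apply: (subset_measure0 (B := (~` `[a, b]%classic : set (measurableTypeR R)))) => //; first exact: measurableC.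
    by move=> z /=; rewrite !in_itv /=; lra.
  (* A law with a density has no atom, so the endpoint [x] can be added; this matters for [x = a],
     which belongs to the support. *)
  rewrite !fE //.
  by rewrite integral_itv_bndo_bndc // => ->.
- move=> x bx; rewrite /law_cdf.
  have -> : (`]-oo, x]%classic : set R) = ~` `]x, +oo[ by rewrite setCitvr.
  rewrite probability_setC //.
  rewrite (subset_measure0 (B := (~` `[a, b]%classic : set (measurableTypeR R)))) // ?sube0 //.
  + exact: measurableC.
  + by move=> z /=; rewrite !in_itv /=; lra.
- move=> x y ax xy yb; rewrite law_cdf_diff //.
  have lE : (lebesgue_measure `]x, y]%classic = (y - x)%:E)%E.
    rewrite lebesgue_measure_itv /= lte_fin; case: ltgtP xy => // -> _.
    by rewrite subrr.
  have fin : mu `]x, y]%classic \is a fin_num by exact: fin_num_measure.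
  have inS z : `]x, y]%classic z -> p <= f z <= q.
    by move=> /=; rewrite in_itv /= => zxy; apply: fpq; rewrite Sab /= in_itv /=; lra.
  rewrite -!lee_fin fineK // fE // !EFinM -lE.
  rewrite -!integral_cst //; apply/andP; split.
  + apply: ge0_le_integral => //; [by move=> z _; rewrite lee_fin ltW|exact: mEf|].
    by move=> z zD; have := inS z zD; rewrite lee_fin; lra.
  + apply: ge0_le_integral => //; [by move=> z _; rewrite lee_fin|exact: mEf|].
    by move=> z zD; have := inS z zD; rewrite lee_fin; lra.
Qed.

End Laws.

(** * Covariance inequalities for comonotone functions *)

Section Association.
Context {d : measure_display} {T : measurableType d} {R : realType}
  (mu : probability T R).
Implicit Types f g X G : T -> R.

Definition bounded_measurable f : Prop :=
  measurable_fun setT f /\ exists M, forall x, `|f x| <= M.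

Lemma bounded_measurable_integrable f : bounded_measurable f ->
  mu.-integrable setT (EFin \o f).
Proof.
move=> [mf [M fM]]; apply: measurable_bounded_integrable => //.
  by apply: le_lt_trans (probability_le1 _ _) (ltry _).
by exists M; split; [exact: num_real|move=> N MN x _; apply: le_trans (fM x) (ltW MN)].
Qed.

Lemma bounded_measurable_cst c : bounded_measurable (fun=> c).
Proof. by split=> //; exists `|c|. Qed.

Lemma bounded_measurableD f g : bounded_measurable f -> bounded_measurable g ->
  bounded_measurable (fun x => f x + g x).
Proof.
move=> [mf [M fM]] [mg [N gN]]; split; first exact: measurable_funD.
by exists (M + N) => x; apply: le_trans (ler_normD _ _) _; exact: lerD.
Qed.

Lemma bounded_measurableM f g : bounded_measurable f -> bounded_measurable g ->
  bounded_measurable (fun x => f x * g x).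
Proof.
move=> [mf [M fM]] [mg [N gN]]; split; first exact: measurable_funM.
by exists (M * N) => x; rewrite normrM ler_pM.
Qed.

Lemma bounded_measurable_indic (A : set T) : measurable A ->
  bounded_measurable (\1_A : T -> R).
Proof.
move=> mA; split; first exact: measurable_indic.
by exists 1 => x; rewrite indicE; case: (_ \in _); rewrite ?normr1 ?normr0.
Qed.

Lemma Rintegral_bmD f g : bounded_measurable f -> bounded_measurable g ->
  \int[mu]_x (f x + g x) = \int[mu]_x f x + \int[mu]_x g x.
Proof. by move=> bf bg; rewrite RintegralD //; exact: bounded_measurable_integrable. Qed.

Lemma Rintegral_bmZ c f : bounded_measurable f ->
  \int[mu]_x (c * f x) = c * \int[mu]_x f x.
Proof. by move=> bf; rewrite RintegralZl //; exact: bounded_measurable_integrable. Qed.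

Lemma Rintegral_prob_cst c : \int[mu]_x c = c.
Proof. 
rewrite Rintegral_cst // -[RHS]mulr1; congr (_ * _).
exact: (congr1 fine (probability_setT mu)). Qed.

Lemma le_Rintegral_bm f g : bounded_measurable f -> bounded_measurable g ->
  (forall x, f x <= g x) -> \int[mu]_x f x <= \int[mu]_x g x.
Proof.
move=> bf bg fg; apply: le_Rintegral => //; exact: bounded_measurable_integrable.
Qed.

Lemma Rintegral_prob_indic (A : set T) : measurable A ->
  \int[mu]_x \1_A x = fine (mu A).
Proof. by move=> mA; rewrite /Rintegral integral_indic // setIT. Qed.

Definition cov X G := \int[mu]_x (X x * G x) - \int[mu]_x X x * \int[mu]_x G x.

Section cov.
Variables (X G : T -> R).
Hypotheses (bX : bounded_measurable X) (bG : bounded_measurable G).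

Let phi y := \int[mu]_x ((X x - X y) * (G x - G y)).

Let bXG := bounded_measurableM bX bG.

Let phiE y : phi y = \int[mu]_x (X x * G x) + (- X y * \int[mu]_x G x
  + (- G y * \int[mu]_x X x + X y * G y)).
Proof.
rewrite -(Rintegral_prob_cst (X y * G y)) -!Rintegral_bmZ //.
have bZ c f : bounded_measurable f -> bounded_measurable (fun x => c * f x).
  by move=> bf; apply: bounded_measurableM => //; exact: bounded_measurable_cst.
rewrite -!Rintegral_bmD //; try by repeat (apply: bounded_measurableD || apply: bZ || apply: bounded_measurable_cst).
by apply: eq_Rintegral => x _; ring.
Qed.

Let bphi : bounded_measurable phi.
Proof.
rewrite (funext phiE).
have bN f : bounded_measurable f -> bounded_measurable (fun x => - f x).
  by move=> [mf [M fM]]; split; [exact: measurable_funN|exists M => x; rewrite normrN].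
repeat (apply: bounded_measurableD || apply: bounded_measurableM || apply: bN
  || apply: bounded_measurable_cst || assumption).
Qed.

Let int_phi : \int[mu]_y phi y = 2 * cov X G.
Proof.
have bZ c f : bounded_measurable f -> bounded_measurable (fun x => c * f x).
  by move=> bf; apply: bounded_measurableM => //; exact: bounded_measurable_cst.
transitivity (\int[mu]_y (\int[mu]_x (X x * G x) + (- (\int[mu]_x G x) * X y
  + (- (\int[mu]_x X x) * G y + X y * G y)))).
  by apply: eq_Rintegral => y _; rewrite phiE; ring.
rewrite !Rintegral_bmD //; try by repeat (apply: bounded_measurableD || apply: bZ || apply: bounded_measurable_cst).
by rewrite !Rintegral_bmZ // Rintegral_prob_cst /cov; ring.
Qed.

(* Double-integral form of the covariance:
   [2 cov X G = int_y int_x (X x - X y) (G x - G y)]. *)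
Lemma cov_ge c (B : set T) : measurable B ->
  (forall x y, 0 <= (X x - X y) * (G x - G y)) ->
  (forall y, B y -> c <= \int[mu]_x ((X x - X y) * (G x - G y))) ->
  c * fine (mu B) <= 2 * cov X G.
Proof.
move=> mB XG0 cB; rewrite -int_phi -Rintegral_prob_indic // -Rintegral_bmZ; last first.
  exact: bounded_measurable_indic.
apply: le_Rintegral_bm => //.
  by apply: bounded_measurableM; [exact: bounded_measurable_cst|exact: bounded_measurable_indic].
move=> y; rewrite indicE; case: (boolP (y \in B)) => [/set_mem By|_].
  by rewrite mulr1 cB.
by rewrite mulr0; apply: Rintegral_ge0 => x _.
Qed.

End cov.

Lemma cov_ge0 X G : bounded_measurable X -> bounded_measurable G ->
  (forall x y, 0 <= (X x - X y) * (G x - G y)) -> 0 <= cov X G.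
Proof.
move=> bX bG XG0; have := @cov_ge _ _ bX bG 0 setT measurableT XG0.
rewrite mul0r pmulr_rge0 //; apply=> y _.
by apply: Rintegral_ge0 => x _.
Qed.

Lemma cov_le0 X G : bounded_measurable X -> bounded_measurable G ->
  (forall x y, (X x - X y) * (G x - G y) <= 0) -> cov X G <= 0.
Proof.
move=> bX bG XG0.
have bN : bounded_measurable (fun x => -1 * G x).
  by apply: bounded_measurableM => //; exact: bounded_measurable_cst.
have : 0 <= cov X (fun x => -1 * G x).
  by apply: cov_ge0 => // x y; have := XG0 x y; nra.
rewrite /cov Rintegral_bmZ //.
have -> : \int[mu]_x (X x * (-1 * G x)) = -1 * \int[mu]_x (X x * G x).
  rewrite -Rintegral_bmZ; last exact: bounded_measurableM.
  by apply: eq_Rintegral => x _; ring.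
lra.
Qed.

(** In the double integral keep only [x] in [A] and [y] in [B], which leaves [k] times the mass of
    [B] times the integral of [G] over [A]. As [G] is larger on [A] than off it, [\1_A] and [G] are
    nonnegatively correlated, so that integral is at least the mass of [A] times the full integral.
    The full integral will be the winning probability, which then cancels. *)
Lemma cov_ge_mass X G (A B : set T) k :
  bounded_measurable X -> bounded_measurable G ->
  measurable A -> measurable B -> 0 <= k ->
  (forall x y, 0 <= (X x - X y) * (G x - G y)) ->
  (forall x y, A x -> ~ A y -> G y <= G x) ->
  (forall x y, A x -> B y -> k * G x <= (X x - X y) * (G x - G y)) ->
  k * fine (mu A) * fine (mu B) * \int[mu]_x G x <= 2 * cov X G.
Proof.
move=> bX bG mA mB k0 XG0 AG kG.
have bA : bounded_measurable (\1_A : T -> R) by exact: bounded_measurable_indic.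
have AE : fine (mu A) * \int[mu]_x G x <= \int[mu]_x (\1_A x * G x).
  have : 0 <= cov \1_A G.
    apply: cov_ge0 => // x y; rewrite !indicE.
    have [/set_mem Ax|/negP Ax] := boolP (x \in A);
    have [/set_mem Ay|/negP Ay] := boolP (y \in A); rewrite ?subrr ?mul0r //=.
    - by rewrite subr0 mul1r subr_ge0 AG // => /mem_set.
    - by rewrite sub0r mulN1r opprB subr_ge0 AG // => /mem_set.
  by rewrite /cov Rintegral_prob_indic // subr_ge0.
apply: (@le_trans _ _ (k * \int[mu]_x (\1_A x * G x) * fine (mu B))).
  rewrite [leLHS](_ : _ = k * (fine (mu A) * \int[mu]_x G x) * fine (mu B)); last by ring.
  by apply: ler_wpM2r; [exact: fine_ge0|exact: ler_wpM2l].
apply: cov_ge => // y By; rewrite -Rintegral_bmZ; last exact: bounded_measurableM.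
have bc c : bounded_measurable (fun=> c) by exact: bounded_measurable_cst.
apply: le_Rintegral_bm.
- by repeat apply: bounded_measurableM.
- by apply: bounded_measurableM; exact: bounded_measurableD.
move=> x; rewrite indicE; case: (boolP (x \in A)) => [/set_mem Ax|_].
  by rewrite mul1r kG.
by rewrite mul0r mulr0.
Qed.

End Association.

(** * Fubini for a variable independent of a pi-system *)

Section Independence.
Context {R : realType} {d : measure_display} {T : measurableType d}
  {P : probability T R}.
Variables (X : {RV P >-> R}) (G : set (set T)).
Hypotheses (Gm : G `<=` measurable) (GI : setI_closed G) (GT : G setT).
Hypothesis indep : forall A E, measurable A -> G E ->
  P (X @^-1` A `&` E) = (P (X @^-1` A) * P E)%E.

(** For fixed [A] both sides are finite measures in [E] that agree on the pi-system [G], hence on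
    the sigma-algebra it generates. *)
Lemma indep_sigma_algebra A E : measurable A -> <<s G >> E ->
  P (X @^-1` A `&` E) = (P (X @^-1` A) * P E)%E.
Proof.
move=> mA sE.
have mXA : measurable (X @^-1` A) by rewrite -[X in measurable X]setTI; exact: measurable_funPT.
have r0 : 0 <= fine (P (X @^-1` A)) by exact: fine_ge0.
pose r := NngNum r0.
have PE : P (X @^-1` A) = (fine (P (X @^-1` A)))%:E by rewrite fineK ?fin_num_measure.
have := @g_sigma_algebra_measure_unique _ R T G Gm (fun=> setT) (fun=> GT) _
  (mrestr P mXA) (mscale r P) GI _ _ E sE.
rewrite /= /mrestr /mscale /= -PE => H; rewrite setIC; apply: H.
- by rewrite bigcup_const //; exists 0%N.
- by move=> B GB; rewrite setIC indep.
- by move=> _; rewrite setTI; apply: le_lt_trans (probability_le1 _ mXA) (ltry _).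
Qed.

(* Giving [T] the sub-sigma-algebra generated by [G] turns independence into the
   statement that [(X, id)] has a product law, so that Fubini applies. *)
Let T' : measurableType _ := g_sigma_algebraType G.

Lemma indep_integral (f : R -> \bar R) (S : set (R * T')) :
  measurable_fun setT f -> (forall x, 0 <= f x)%E -> measurable S ->
  (\int[P]_w (f (X w) * (\1_S (X w, w))%:E) =
   \int[distribution P X]_x (f x * P [set w | S (x, w)]))%E.
Proof.
move=> mf f0 mS.
have mid : measurable_fun setT (id : T -> T').
  move=> _ B sB; rewrite setTI preimage_id.
  exact: (smallest_sub (@sigma_algebra_measurable _ T) Gm).
pose idm : {mfun T >-> T'} := mfun_Sub (mem_set mid).
pose P' : probability T' R := distribution P idm.
have mj : measurable_fun setT (fun w : T => (X w, w : T')).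
  by apply: measurable_fun_pair.
pose jm : {mfun T >-> (R * T')%type} := mfun_Sub (mem_set mj).
pose g (z : R * T') : \bar R := (f z.1 * (\1_S z)%:E)%E.
have mg : measurable_fun setT g.
  apply: emeasurable_funM; first exact: measurableT_comp.
  by apply/measurable_EFinP; exact: measurable_indic.
have g0 z : (0 <= g z)%E by rewrite mule_ge0 // lee_fin.
transitivity (\int[distribution P jm]_z g z)%E.
  by rewrite ge0_integral_distribution.
transitivity (\int[distribution P X \x P']_z g z)%E.
  (* Independence gives the product formula on rectangles, which determines the product measure. *)
  apply: eq_measure_integral => A mA _; apply/esym.
  apply: product_measure_unique => //= A1 A2 mA1 mA2.
  rewrite /distribution /pushforward /=.
  by rewrite -[RHS]indep_sigma_algebra.
rewrite fubini_tonelli1 //; apply: eq_integral => x _; rewrite /fubini_F /g /=.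
have mS1 : measurable_fun setT (fun y : T' => (\1_S (x, y))%:E : \bar R).
  by apply/measurable_EFinP; apply: measurableT_comp; [exact: measurable_indic|exact: pair1_measurable].
rewrite ge0_integralZl //.
congr (_ * _)%E.
transitivity (\int[P']_w (\1_(xsection S x) w)%:E)%E.
  by apply: eq_integral => w _; rewrite !indicE mem_xsection.
rewrite integral_indic ?setIT //; last exact: measurable_xsection.
by congr (P _); apply/seteqP; split => w /=; rewrite xsectionE.
Qed.

Lemma slice_measurable (S : set (R * T')) x : measurable S -> d.-measurable [set w : T | S (x, w)].
Proof.
move=> mS; apply: (smallest_sub (@sigma_algebra_measurable _ T) Gm).
have : (measurable : set (set T')) (xsection S x) by exact: measurable_xsection.
by rewrite xsectionE.
Qed.

(** A version of the conditional probability, given [X = x], of the event that [(X w, w)] lies in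
    [S]. *)
Definition slice_prob (S : set (R * T')) x : R := fine (P [set w | S (x, w)]).

Lemma bounded_measurable_slice_prob (S : set (R * T')) : measurable S ->
  bounded_measurable (slice_prob S).
Proof.
move=> mS; split; last first.
  exists 1 => x; have mSx := slice_measurable x mS.
  rewrite ger0_norm ?fine_ge0 // -lee_fin fineK ?fin_num_measure //.
  exact: probability_le1.
have mid : measurable_fun setT (id : T -> T').
  move=> _ B sB; rewrite setTI preimage_id.
  exact: (smallest_sub (@sigma_algebra_measurable _ T) Gm).
pose idm : {mfun T >-> T'} := mfun_Sub (mem_set mid).
have -> : slice_prob S = fine \o (distribution P idm \o xsection S).
  apply/funext => x /=; rewrite /slice_prob /distribution /pushforward /=.
  by congr (fine (P _)); rewrite xsectionE.
by apply: measurableT_comp => //; exact: measurable_fun_xsection.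
Qed.

Lemma Rintegral_slice (f : R -> R) (S : set (R * T')) :
  measurable_fun setT f -> (forall x, 0 <= f x) -> measurable S ->
  \int[P]_w (f (X w) * \1_S (X w, w)) =
  \int[distribution P X]_x (f x * slice_prob S x).
Proof.
move=> mf f0 mS; rewrite /Rintegral; congr fine.
transitivity (\int[P]_w ((EFin \o f) (X w) * (\1_S (X w, w))%:E))%E.
  by apply: eq_integral => w _; rewrite EFinM.
have mEf : measurable_fun setT (EFin \o f) by exact/measurable_EFinP.
rewrite indep_integral //.
apply: eq_integral => x _; rewrite EFinM /slice_prob fineK //.
by apply: fin_num_measure; exact: slice_measurable.
Qed.

End Independence.

(** * Winning events as sets in one variable and the remaining ones *)

Section Model.
Context {R : realType} {d : measure_display} {T : measurableType d}
  {P : probability T R} {n : nat}.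
Variables (u : 'I_n -> {RV P >-> R}) (beta : 'I_n -> R).
Hypothesis indep : mutually_independent u.

Lemma measurable_RV (X : {RV P >-> R}) (A : set R) : measurable A ->
  d.-measurable (X @^-1` A).
Proof. by move=> mA; rewrite -[X in measurable X]setTI; exact: measurable_funPT. Qed.

(** These sets form a pi-system generating the information carried by the variables other than
    [u i]. *)
Definition cylinder i (B : 'I_n -> set R) : set T :=
  [set w | forall k, k != i -> B k (u k w)].

Definition cylinders i : set (set T) :=
  [set E | exists B, (forall k, measurable (B k)) /\ E = cylinder i B].

Lemma cylinderE i B :
  cylinder i B = \bigcap_(k in [set` [set~ i]%SET]) (u k @^-1` B k).
Proof.
by apply/seteqP; split=> w /= h k; have := h k; rewrite /= !inE.
Qed.

Lemma measurable_cylinder i B : (forall k, measurable (B k)) ->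
  d.-measurable (cylinder i B).
Proof.
move=> mB; rewrite cylinderE; apply: fin_bigcap_measurable => // k _.
exact: measurable_RV.
Qed.

Lemma cylinders_measurable i : cylinders i `<=` measurable.
Proof. by move=> _ [B [mB ->]]; exact: measurable_cylinder. Qed.

Lemma cylindersI i : setI_closed (cylinders i).
Proof.
move=> _ _ [B [mB ->]] [C [mC ->]]; exists (fun k => B k `&` C k); split.
  by move=> k; exact: measurableI.
by apply/seteqP; split=> w /= => [[h1 h2] k ki|h];
  [split; [exact: h1|exact: h2]|split=> k ki; case: (h k ki)].
Qed.

Lemma cylindersT i : cylinders i setT.
Proof. by exists (fun=> setT); split => //; apply/esym/seteqP; split. Qed.

(** Putting [A] in the free slot [i] turns the intersection into one product event over all
    indices. *)
Lemma cylinder_indep i A E : measurable A -> cylinders i E ->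
  P (u i @^-1` A `&` E) = (P (u i @^-1` A) * P E)%E.
Proof.
move=> mA [B [mB ->]]; pose C k := if k == i then A else B k.
have mC k : measurable (C k) by rewrite /C; case: ifP.
have -> : u i @^-1` A `&` cylinder i B =
    \bigcap_(k in [set` [set: 'I_n]%SET]) (u k @^-1` C k).
  apply/seteqP; split => w /=.
    by move=> [Aw Bw] k _; rewrite /C /=; case: eqP => [->//|/eqP]; exact: Bw.
  move=> h; split; first by have := h i; rewrite /C eqxx /= inE; exact.
  by move=> k ki; have := h k; rewrite /C (negPf ki) /= inE; exact.
rewrite cylinderE !indep // (bigD1 i) ?inE //= /C eqxx; congr (_ * _)%E.
by apply: eq_big => k; rewrite ?inE // => ki; rewrite (negPf ki).
Qed.

Definition beats i := [set w | forall k, beta k * u k w <= beta i * u i w].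

Lemma max_eventE i : max_event u beta i = beats i.
Proof.
apply/seteqP; split => w /=.
  move=> h k; rewrite -lee_fin h; exact: (le_bigmax _ (fun k => (beta k * u k w)%:E)).
move=> h; apply/eqP; rewrite eq_le; apply/andP; split.
  exact: (le_bigmax _ (fun k => (beta k * u k w)%:E)).
by apply: bigmax_le => [|k _]; rewrite ?leNye // lee_fin.
Qed.

Let T' i : measurableType _ := g_sigma_algebraType (cylinders i).

Lemma measurable_other i k : k != i -> measurable_fun setT (u k : T' i -> R).
Proof.
move=> ki _ A mA; rewrite setTI; apply: sub_sigma_algebra.
exists (fun l => if l == k then A else setT); split; first by move=> l; case: ifP.
apply/seteqP; split => w /=; first by move=> Aw l li; case: eqP => [->|].
by move=> /(_ k ki); rewrite eqxx.
Qed.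

Lemma measurable_beats i : d.-measurable (beats i).
Proof.
have -> : beats i = \bigcap_(k in [set: 'I_n]) [set w | beta k * u k w <= beta i * u i w].
  by apply/seteqP; split => w /= h k => [_|]; exact: h.
apply: fin_bigcap_measurable => // k _; rewrite -[X in measurable X]setTI.
by apply: measurable_fun_le => //; apply: measurable_funM.
Qed.

(** [z.1] stands for the value of [u i], and [z.2] is seen only through the other variables. The
    index [k = i] is left out because [u i] need not be measurable on [T' i]. *)
Definition own_win i : set (R * T' i) :=
  [set z | forall k, k != i -> beta k * u k z.2 <= beta i * z.1].
Local Arguments own_win i _ : clear implicits.

Lemma measurable_own_win i : measurable (own_win i).
Proof.
have -> : own_win i = \bigcap_(k in [set` [set~ i]%SET])
    [set z | beta k * u k z.2 <= beta i * z.1].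
  by apply/seteqP; split => w /= h k; have := h k; rewrite /= !inE.
apply: fin_bigcap_measurable => // k /=; rewrite !inE => ki.
rewrite -[X in measurable X]setTI; apply: measurable_fun_le => //.
- apply: measurable_funM => //; apply: (measurableT_comp (measurable_other ki)).
  exact: measurable_snd.
- by apply: measurable_funM => //; exact: measurable_fst.
Qed.

(** For [j != i] the value of [u i] enters only as [z.1], in a single upper bound, so slices shrink
    as [z.1] grows. *)
Definition other_win i j : set (R * T' i) :=
  [set z | beta i * z.1 <= beta j * u j z.2 /\
     forall k, k != i -> beta k * u k z.2 <= beta j * u j z.2].
Local Arguments other_win i j _ : clear implicits.

Lemma measurable_other_win i j : j != i -> measurable (other_win i j).
Proof.
move=> ji.
have m2 k : k != i -> measurable_fun setT (fun z : R * T' i => beta k * u k z.2).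
  move=> ki; apply: measurable_funM => //.
  by apply: (measurableT_comp (measurable_other ki)); exact: measurable_snd.
apply: measurableI.
  rewrite -[X in measurable X]setTI; apply: measurable_fun_le => //; last exact: m2.
  by apply: measurable_funM => //; exact: measurable_fst.
rewrite [X in measurable X](_ : _ = \bigcap_(k in [set` [set~ i]%SET])
    [set z : R * T' i | beta k * u k z.2 <= beta j * u j z.2]); last first.
  by apply/seteqP; split => w /= h k; have := h k; rewrite /= !inE.
apply: fin_bigcap_measurable => // k /=; rewrite !inE => ki.
by rewrite -[X in measurable X]setTI; apply: measurable_fun_le => //; exact: m2.
Qed.

Lemma own_winE i w : own_win i (u i w, w) <-> beats i w.
Proof.
split=> [h k|h k _]; last exact: h.
by have [->//|ki] := eqVneq k i; exact: h.
Qed.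

Lemma other_winE i j w : other_win i j (u i w, w) <-> beats j w.
Proof.
split=> [[hi h] k|h]; last by split=> [|k _]; exact: h.
by have [->//|ki] := eqVneq k i; exact: h.
Qed.

End Model.
Arguments own_win {R d T P n} u beta i _.
Arguments other_win {R d T P n} u beta i j _.

(** * Conditional expectations as covariances *)

Section Conditional.
Context {R : realType} {d : measure_display} {T : measurableType d}
  {P : probability T R} {n : nat}.
Variable u : 'I_n -> {RV P >-> R}.
Hypothesis indep : mutually_independent u.
Variables (p q : R) (a b : 'I_n -> R).

Definition rv_cdf (X : {RV P >-> R}) x : R := fine (P (X @^-1` `]-oo, x]%classic)).

Hypothesis slope : forall k, cdf_slope p q (a k) (b k) (rv_cdf (u k)).

Lemma probability_fineK (A : set T) : measurable A -> P A = (fine (P A))%:E.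
Proof. by move=> mA; rewrite fineK // fin_num_measure. Qed.

Lemma rv_cdfE (X : {RV P >-> R}) x :
  P (X @^-1` `]-oo, x]%classic) = (rv_cdf X x)%:E.
Proof.
by apply: probability_fineK; exact: measurable_RV.
Qed.

Lemma rv_cdfC (X : {RV P >-> R}) x :
  P (X @^-1` `]x, +oo[%classic) = (1 - rv_cdf X x)%:E.
Proof.
have mX : d.-measurable (X @^-1` `]-oo, x]%classic) by exact: measurable_RV.
by rewrite -setCitvl preimage_setC (probability_setC P mX) rv_cdfE.
Qed.

(* [u_i] lies in [[0, 1]] only almost surely; clamping makes it bounded everywhere. *)
Definition clamp (x : R) : R := Num.max 0 (Num.min 1 x).

Lemma clamp_id x : 0 <= x -> x <= 1 -> clamp x = x.
Proof. by move=> x0 x1; rewrite /clamp min_r // max_r. Qed.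

Lemma clamp_ge0 x : 0 <= clamp x.
Proof. by rewrite /clamp le_max lexx. Qed.

Lemma clamp_homo x y : x <= y -> clamp x <= clamp y.
Proof.
by move=> xy; rewrite /clamp /Num.max /Num.min; repeat case: ifPn => //; rewrite -?leNgt; lra.
Qed.

Lemma bounded_measurable_clamp : bounded_measurable clamp.
Proof.
split.
  by apply: measurable_maxr => //; apply: measurable_minr.
by exists 1 => x; rewrite ger0_norm ?clamp_ge0 // /clamp ge_max ler01 ge_min lexx.
Qed.

Lemma clamp_ae i : P.-negligible [set w | clamp (u i w) <> u i w].
Proof.
have [a0 b1 Fa Fb _] := slope i.
apply: (@negligibleS _ _ _ _ (u i @^-1` `]-oo, 0%R]%classic `|` u i @^-1` `]1%R, +oo[%classic)).
  move=> w /= uw; rewrite !in_itv /= andbT.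
  have [w0|w0] := leP (u i w) 0; first by left.
  have [w1|w1] := leP (u i w) 1; last by right.
  by case: uw; rewrite clamp_id // ltW.
apply: negligibleU; apply/negligibleP.
- exact: measurable_RV.
- by have := rv_cdfE (u i) 0; rewrite Fa.
- exact: measurable_RV.
- by have := rv_cdfC (u i) 1; rewrite Fb // subrr.
Qed.

Lemma cond_num i (W : set T) : measurable W ->
  \int[P]_(w in W) u i w = \int[P]_w (clamp (u i w) * \1_W w).
Proof.
move=> mW; rewrite Rintegral_mkcond /Rintegral; congr fine.
apply: ae_eq_integral => //.
- have mu_i : measurable_fun W (u i) by exact: measurable_funTS.
  by apply/measurable_EFinP; exact: (iffLR (measurable_restrictT (u i) mW) mu_i).
- apply/measurable_EFinP; apply: measurable_funM; last exact: measurable_indic.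
  by apply: measurableT_comp => //; case: bounded_measurable_clamp.
have := clamp_ae i; apply: negligibleS => w /= /not_implyP[_] h uw; apply: h.
by rewrite patchE indicE; case: ifP => _; rewrite ?mulr1 ?mulr0 // uw.
Qed.

Local Notation mu i := (distribution P (u i)).

(** Integrating out the other variables turns the numerator of the conditional expectation into the
    integral of [clamp] times the slice probability, and [P W] into the integral of the slice
    probability. Subtracting the product of the means leaves the covariance. *)
Lemma cond_slice i (S : set (R * g_sigma_algebraType (cylinders u i))) W :
  measurable S -> (forall w, S (u i w, w) <-> W w) -> measurable W ->
  0 < fine (P W) ->
  cond_expectation (u i) W = \int[mu i]_x clamp x +
    cov (mu i) clamp (slice_prob (P := P) S) / fine (P W) /\
  fine (P W) = \int[mu i]_x slice_prob (P := P) S x.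
Proof.
move=> mS SW mW W0.
have ind w : \1_S (u i w, w) = \1_W w :> R.
  rewrite !indicE; congr ((nat_of_bool _)%:R).
  by apply/idP/idP => /set_mem/SW/mem_set.
have Gm := @cylinders_measurable _ _ _ _ _ u i.
have GI := @cylindersI _ _ _ _ _ u i.
have GT := @cylindersT _ _ _ _ _ u i.
have Gi := cylinder_indep indep (i := i).
have [mc _] := bounded_measurable_clamp.
have sl f := @Rintegral_slice _ _ _ _ (u i) _ Gm GI GT Gi f S.
have PW : fine (P W) = \int[mu i]_x slice_prob (P := P) S x.
  transitivity (\int[mu i]_x (1 * slice_prob (P := P) S x)).
    rewrite -(sl (fun=> 1)) // -Rintegral_prob_indic //.
    by apply: eq_Rintegral => w _; rewrite ind mul1r.
  by apply: eq_Rintegral => w _; rewrite mul1r.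
split=> //; rewrite /cond_expectation cond_num //.
have -> : \int[P]_w (clamp (u i w) * \1_W w) =
    \int[mu i]_x (clamp x * slice_prob (P := P) S x).
  rewrite -sl //; last exact: clamp_ge0.
  by apply: eq_Rintegral => w _; rewrite ind.
by rewrite /cov -PW; field; rewrite gt_eqF.
Qed.

End Conditional.

(** * Consequences of the slope bounds on a distribution function *)

Section Slope.
Context {R : realType}.
Variables (p q a b : R) (F : R -> R).
Hypotheses (p_gt0 : 0 < p) (q_gt0 : 0 < q) (sl : cdf_slope p q a b F).

Lemma cdf_slope_lt : a < b.
Proof.
have [_ _ Fa Fb _] := sl; rewrite ltNge; apply/negP => ba.
by have := Fb a ba; rewrite (Fa a) // => /eqP; rewrite eq_sym oner_eq0.
Qed.

Lemma cdf_slope_width : 1 <= q * (b - a).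
Proof.
have [_ _ Fa Fb h] := sl; have ab := ltW cdf_slope_lt.
by have := h a b (lexx _) ab (lexx _); rewrite (Fa a) // (Fb b) //; lra.
Qed.

Let pM x y : x <= y -> 0 <= p * (y - x).
Proof. by move=> xy; rewrite mulr_ge0 ?subr_ge0 // ltW. Qed.

Lemma cdf_slope_ge0 x : 0 <= F x.
Proof.
have [_ _ Fa Fb h] := sl; have ab := ltW cdf_slope_lt.
have [xa|ax] := leP x a; first by rewrite Fa.
have [bx|xb] := leP b x; first by rewrite Fb.
by have := h a x (lexx _) (ltW ax) (ltW xb); have := pM (ltW ax); rewrite (Fa a) //; lra.
Qed.

Lemma cdf_slope_le1 x : F x <= 1.
Proof.
have [_ _ Fa Fb h] := sl; have ab := ltW cdf_slope_lt.
have [xa|ax] := leP x a; first by rewrite Fa.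
have [bx|xb] := leP b x; first by rewrite Fb.
by have := h x b (ltW ax) (ltW xb) (lexx _); have := pM (ltW xb); rewrite (Fb b) //; lra.
Qed.

Lemma cdf_slope_homo x y : x <= y -> F x <= F y.
Proof.
have [_ _ Fa Fb h] := sl => xy.
have [xa|ax] := leP x a; first by rewrite (Fa x) // cdf_slope_ge0.
have [bY|yb] := leP b y; first by rewrite (Fb y) // cdf_slope_le1.
by have := h x y (ltW ax) xy (ltW yb); have := pM xy; lra.
Qed.

(** Starting from [F a = 0] with [a >= 0], [F] rises at rate at most [q]; beyond [b] the width bound
    gives [1 <= q * (b - a) <= q * x]. *)
Lemma cdf_slope_le_lin x : 0 <= x -> F x <= q * x.
Proof.
have [a0 _ Fa Fb h] := sl => x0; have ab := cdf_slope_lt.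
have [xa|ax] := leP x a; first by rewrite Fa // mulr_ge0 // ltW.
have [bx|xb] := leP b x.
  by rewrite Fb //; apply: le_trans cdf_slope_width _; rewrite ler_pM2l //; lra.
by have := h a x (lexx _) (ltW ax) (ltW xb); have := mulr_ge0 (ltW q_gt0) a0; rewrite (Fa a) //; lra.
Qed.

(** Past [a], [F] gains at least [e], and [e >= e * F x] because [F x <= 1]. The bound [y <= b]
    keeps the interval where the lower slope is available. *)
Lemma cdf_slope_growth x y e : x <= y -> y <= b -> 0 <= e -> e <= p * (y - x) ->
  (1 + e) * F x <= F y.
Proof.
have [_ _ Fa _ h] := sl => xy yb e0 exy.
have [xa|ax] := leP x a; first by rewrite Fa // mulr0 cdf_slope_ge0.
have := h x y (ltW ax) xy yb; have := cdf_slope_le1 x; have := cdf_slope_ge0 x.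
nra.
Qed.

End Slope.

(* [1 + e] is the growth ratio of the winning probability between [s] and [t], see
   [own_gap]. *)
Definition gap_const {R : realType} (p q : R) : R :=
  let e := p / (32 * q ^+ 2) in
  (8 * q)^-1 * (e / (1 + e)) * (3 / 4) * (p * (8 * q)^-1) / 2.

(** * Lower bound for the own-win gap, upper bound for the other-win gap *)

Section Gap.
Context {R : realType} {d : measure_display} {T : measurableType d}
  {P : probability T R} {n : nat}.
Variables (u : 'I_n -> {RV P >-> R}) (beta : 'I_n -> R).
Hypotheses (indep : mutually_independent u) (beta_gt0 : forall k, 0 < beta k).
Variables (p q : R) (a b : 'I_n -> R).
Hypotheses (p_gt0 : 0 < p) (q_gt0 : 0 < q).
Hypothesis slope : forall k, cdf_slope p q (a k) (b k) (rv_cdf (u k)).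

Lemma probability_cylinder i (x : 'I_n -> R) :
  fine (P (cylinder u i (fun k => `]-oo, x k]%classic))) =
  \prod_(k | k != i) rv_cdf (u k) (x k).
Proof.
rewrite cylinderE indep //.
rewrite -[RHS]/(fine _%:E) -prodEFin; congr fine.
by apply: eq_big => [k|k _]; [rewrite !inE|exact: rv_cdfE].
Qed.

Lemma own_win_slice i x : slice_prob (P := P) (own_win u beta i) x =
  \prod_(k | k != i) rv_cdf (u k) (beta i * x / beta k).
Proof.
rewrite -probability_cylinder; congr (fine (P _)).
apply/seteqP; split => w /= h k ki; have := h k ki;
  by rewrite /= in_itv /= ler_pdivlMr // mulrC.
Qed.

Lemma own_win_slice_homo i x y : x <= y ->
  slice_prob (P := P) (own_win u beta i) x <= slice_prob (P := P) (own_win u beta i) y.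
Proof.
move=> xy; rewrite !own_win_slice; apply: ler_prod => k ki.
rewrite (cdf_slope_ge0 p_gt0 (slope k)) /=; apply: (cdf_slope_homo p_gt0 (slope k)).
by rewrite ler_pM2r ?invr_gt0 // ler_pM2l.
Qed.

Lemma own_win_slice_ge0 i x : 0 <= slice_prob (P := P) (own_win u beta i) x.
Proof. exact: fine_ge0. Qed.

(** The factor of [k] in the product supplies the ratio [1 + e]; the other factors are
    nondecreasing. *)
Lemma own_win_slice_growth i k s t e : k != i -> s <= t ->
  beta i * t <= beta k * b k -> 0 <= e -> e <= p * (beta i / beta k * (t - s)) ->
  (1 + e) * slice_prob (P := P) (own_win u beta i) s <=
  slice_prob (P := P) (own_win u beta i) t.
Proof.
move=> ki st tb e0 ep; rewrite !own_win_slice !(bigD1 k ki) /= mulrA.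
have st' l : beta i * s / beta l <= beta i * t / beta l.
  by rewrite ler_pM2r ?invr_gt0 // ler_pM2l.
have F0 l x := cdf_slope_ge0 p_gt0 (slope l) x.
apply: ler_pM.
- by rewrite mulr_ge0 // addr_ge0.
- by apply: prodr_ge0 => l _.
- apply: (cdf_slope_growth p_gt0 (slope k)) => //.
    by rewrite ler_pdivrMr // (mulrC (b k)).
  by apply: le_trans ep _; rewrite le_eqVlt; apply/orP; left; apply/eqP; ring.
- by apply: ler_prod => l _; rewrite F0 /=; exact: (cdf_slope_homo p_gt0 (slope l)).
Qed.

(* Condition on [E]: [X_l <= beta_i] for all [l <> k].  Up to a null set, [i] wins only
   if [E] holds and [u_k <= r]; [k] wins if [E] holds and [u_k > r]. *)
Lemma win_ratio i k : k != i -> fine (P (beats u beta k)) < 3 * fine (P (beats u beta i)) ->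
  beta k < 4 * q * beta i.
Proof.
move=> ki ratio; pose r := beta i / beta k.
have r0 : 0 < r by exact: divr_gt0.
(* At [l = i] the bound [beta i / beta i] is written as 1, the top of the range of [u i]. *)
pose B l : set R := if l == i then `]-oo, 1]%classic else `]-oo, beta i / beta l]%classic.
have mB l : measurable (B l) by rewrite /B; case: ifP.
pose E := cylinder u k B.
have mE : d.-measurable E by exact: measurable_cylinder.
have cE : cylinders u k E by exists B.
have mU x : d.-measurable (u k @^-1` `]-oo, x]%classic) by exact: measurable_RV.
have mV l x : d.-measurable (u l @^-1` `]x, +oo[%classic) by exact: measurable_RV.
have [_ b1 _ Fb _] := slope i.
have le_i : fine (P (beats u beta i)) <= rv_cdf (u k) r * fine (P E).
  have low : P (u k @^-1` `]-oo, r]%classic `&` E) = (rv_cdf (u k) r * fine (P E))%:E.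
    by rewrite (cylinder_indep indep) // rv_cdfE (probability_fineK mE).
  rewrite -lee_fin -probability_fineK; last exact: measurable_beats.
  rewrite -low -[leRHS]adde0.
  have <- : P (u i @^-1` `]1%R, +oo[%classic) = 0%E by rewrite rv_cdfC Fb // subrr.
  apply: le_trans (measureU2 _ _ _).
  - apply: le_measure; rewrite ?inE; [exact: measurable_beats| |].
      by apply: measurableU => //; exact: measurableI.
    move=> w bw; have [w1|w1] := leP (u i w) 1; last first.
      by right; rewrite /= in_itv /= w1.
    have le_beta l : u l w <= beta i / beta l.
      by rewrite ler_pdivlMr // mulrC; apply: le_trans (bw l) _; rewrite ger_pMr.
    left; split; first by rewrite /= in_itv /=.
    by move=> l _; rewrite /B; case: eqP => [->|_]; rewrite /= in_itv /=.
  - exact: measurableI.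
  - exact: mV.
have ge_k : (1 - rv_cdf (u k) r) * fine (P E) <= fine (P (beats u beta k)).
  have high : P (u k @^-1` `]r, +oo[%classic `&` E) =
      ((1 - rv_cdf (u k) r) * fine (P E))%:E.
    by rewrite (cylinder_indep indep) // rv_cdfC (probability_fineK mE).
  rewrite -lee_fin -probability_fineK; last exact: measurable_beats.
  rewrite -high; apply: le_measure; rewrite ?inE.
  - by apply: measurableI.
  - exact: measurable_beats.
  move=> w [/= wr Ew] l.
  move: wr; rewrite in_itv /= andbT /r ltr_pdivrMr // mulrC => wr.
  have [->//|lk] := eqVneq l k; apply: le_trans (ltW wr).
  have := Ew l lk; rewrite /B; case: eqP => [->|_]; rewrite /= in_itv /=.
    by move=> u1; rewrite ger_pMr.
  by rewrite ler_pdivlMr // mulrC.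
(* If the cdf at [r] were at most 1/4, its complement would be at least three times as large, and
   [k] would win at least three times as often as [i]. *)
have r_gt : 1 < 4 * rv_cdf (u k) r.
  have e0 : 0 <= fine (P E) by exact: fine_ge0.
  rewrite ltNge; apply/negP => r1; move: ratio; rewrite ltNge => /negP; apply.
  apply: le_trans ge_k; apply: (@le_trans _ _ (3 * (rv_cdf (u k) r * fine (P E)))).
    by rewrite ler_pM2l.
  by rewrite mulrA ler_wpM2r //; lra.
have := cdf_slope_le_lin q_gt0 (slope k) (ltW r0).
move=> rq; have {rq} rq : 1 < 4 * (q * r) by lra.
have rE : r * beta k = beta i by rewrite divfK ?gt_eqF.
have : beta k * 1 < beta k * (4 * (q * r)) by rewrite ltr_pM2l.
by rewrite -rE; lra.
Qed.

Local Notation mu i := (distribution P (u i)).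

Lemma own_slice i : 0 < fine (P (beats u beta i)) ->
  cond_expectation (u i) (beats u beta i) = \int[mu i]_x clamp x +
    cov (mu i) clamp (slice_prob (P := P) (own_win u beta i)) / fine (P (beats u beta i)) /\
  fine (P (beats u beta i)) = \int[mu i]_x slice_prob (P := P) (own_win u beta i) x.
Proof.
move=> Pi; apply: (cond_slice indep slope) => //.
- exact: measurable_own_win.
- by move=> w; exact: own_winE.
- exact: measurable_beats.
Qed.

Lemma bounded_measurable_own_slice i :
  bounded_measurable (slice_prob (P := P) (own_win u beta i)).
Proof.
apply: bounded_measurable_slice_prob; last exact: measurable_own_win.
exact: cylinders_measurable.
Qed.

(** If every competitor's scaled support ended below [beta i * t], then [i] would win almost surely
    once [u i] exceeds [t], contradicting the bound on its winning probability. *)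
Lemma exists_competitor i t : 0 < fine (P (beats u beta i)) ->
  fine (P (beats u beta i)) < 1 - rv_cdf (u i) t ->
  exists2 k, k != i & beta i * t <= beta k * b k.
Proof.
move=> Pi Pt; apply: contrapT => none.
have top k : k != i -> beta k * b k < beta i * t.
  by move=> ki; rewrite ltNge; apply/negP => le; apply: none; exists k.
move: Pt; rewrite ltNge => /negP; apply.
rewrite (own_slice Pi).2.
have mt : measurable (`]t, +oo[%classic : set R) by exact: measurable_itv.
have -> : 1 - rv_cdf (u i) t = \int[mu i]_x \1_(`]t, +oo[%classic) x.
  rewrite Rintegral_prob_indic //.
  by have := congr1 fine (rv_cdfC (u i) t) => /= <-.
apply: le_Rintegral_bm.
- exact: bounded_measurable_indic.
- exact: bounded_measurable_own_slice.
move=> x; rewrite indicE; case: (boolP (x \in _)) => [/set_mem|_]; last exact: own_win_slice_ge0.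
rewrite /= in_itv /= andbT => tx; rewrite own_win_slice big1 // => k ki.
have [_ _ _ Fb _] := slope k; apply: Fb.
rewrite ler_pdivlMr // mulrC; apply: le_trans (ltW (top k ki)) _.
by rewrite ler_pM2l // ltW.
Qed.

Lemma own_gap i : 0 < fine (P (beats u beta i)) ->
  fine (P (beats u beta i)) < 3 / 4 ->
  (forall k, k != i -> fine (P (beats u beta k)) < 3 * fine (P (beats u beta i))) ->
  gap_const p q + \int[mu i]_x clamp x <= cond_expectation (u i) (beats u beta i).
Proof.
move=> Pi Pi34 ratio; have [-> PE] := own_slice Pi.
set g := slice_prob (P := P) (own_win u beta i) in PE *.
rewrite addrC lerD2l ler_pdivlMr //.
have [a0 b1 Fa _ h] := slope i.
have width := cdf_slope_width (slope i).
have ab := ltW (cdf_slope_lt (slope i)).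
(* The slope [q] leaves mass at most 1/4 below [t], and the slope [p] puts mass at least
   [p / (8 * q)] below [s]. Both points lie in the support, whose width is at least [1 / q]. *)
pose s := a i + (8 * q)^-1; pose t := a i + (4 * q)^-1.
have q8 : 0 < (8 * q)^-1 by rewrite invr_gt0 mulr_gt0.
have q4E : (4 * q)^-1 = 2 * (8 * q)^-1 by field; rewrite gt_eqF.
have q8E : q * (8 * q)^-1 = 1 / 8 by field; rewrite gt_eqF.
have st : s <= t by rewrite /s /t q4E; lra.
have sa : a i <= s by rewrite /s; lra.
have tb : t <= b i.
  rewrite -subr_ge0 -(pmulr_rge0 _ q_gt0) /t q4E; lra.
have Ft : rv_cdf (u i) t <= 1 / 4.
  have := h _ _ (lexx _) (le_trans sa st) tb; rewrite (Fa (a i)) // /t q4E; lra.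
have Fs : p * (8 * q)^-1 <= rv_cdf (u i) s.
  have := h _ _ (lexx _) sa (le_trans st tb); rewrite (Fa (a i)) // /s; lra.
have [k ki kt] : exists2 k, k != i & beta i * t <= beta k * b k.
  by apply: exists_competitor => //; lra.
have bk := win_ratio ki (ratio k ki).
(* This is [p] times [1 / (4 * q)], a lower bound for [beta i / beta k], times
   [t - s = 1 / (8 * q)]. *)
pose e := p / (32 * q ^+ 2).
have e0 : 0 < e by rewrite divr_gt0 // mulr_gt0 // exprn_gt0.
have eE : e <= p * (beta i / beta k * (t - s)).
  have -> : t - s = (8 * q)^-1 by rewrite /t /s q4E; ring.
  have -> : e = p * ((4 * q)^-1 * (8 * q)^-1) by rewrite /e; field; rewrite gt_eqF.
  rewrite ler_pM2l // ler_pM2r // ler_pdivlMr // ler_pdivrMl ?mulr_gt0 //.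
  exact: ltW.
have growth : (1 + e) * g s <= g t by apply: (own_win_slice_growth ki) => //; exact: ltW.
have ts : t - s = (8 * q)^-1 by rewrite /t /s q4E; ring.
pose A : set R := `]t, +oo[%classic; pose B : set R := `]-oo, s]%classic.
have mA : measurable A by exact: measurable_itv.
have mB : measurable B by exact: measurable_itv.
have gm x y : x <= y -> g x <= g y by exact: own_win_slice_homo.
have g0 x : 0 <= g x by exact: own_win_slice_ge0.
(* For [x] above [t] and [y] at most [s], the clamped values differ by at least [t - s]. Also [g y
   <= g s <= g t / (1 + e) <= g x / (1 + e)], so [g] loses at least the fraction [e / (1 + e)] of
   [g x]. *)
pose c := (8 * q)^-1 * (e / (1 + e)).
have c0 : 0 < c by rewrite mulr_gt0 // divr_gt0 // addr_gt0.
have := @cov_ge_mass _ _ _ (mu i) clamp g A B c.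
have -> : fine (mu i A) = 1 - rv_cdf (u i) t.
  by have := congr1 fine (rv_cdfC (u i) t) => /= <-.
have -> : fine (mu i B) = rv_cdf (u i) s by [].
rewrite -PE => cov_low.
have {}cov_low : c * (1 - rv_cdf (u i) t) * rv_cdf (u i) s *
    fine (P (beats u beta i)) <= 2 * cov (mu i) clamp g.
  apply: cov_low => //.
  - exact: bounded_measurable_clamp.
  - exact: bounded_measurable_own_slice.
  - exact: ltW.
  - move=> x y; have [xy|/ltW yx] := leP x y.
      by rewrite mulr_le0 // subr_le0 ?clamp_homo ?gm.
    by rewrite mulr_ge0 // subr_ge0 ?clamp_homo ?gm.
  - move=> x y; rewrite /A /= !in_itv /= !andbT => tx /negP; rewrite -leNgt => yt.
    by apply: gm; apply: le_trans yt (ltW tx).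
  - move=> x y; rewrite /A /B /= !in_itv /= andbT => tx ys.
    (* [s] and [t] lie in [[0, 1]], so clamping fixes them and monotonicity transfers the bounds. *)
    have vx : t <= clamp x.
      rewrite -[leLHS]clamp_id ?clamp_homo //; [exact: ltW|lra|lra].
    have vy : clamp y <= s.
      by rewrite -[leRHS]clamp_id ?clamp_homo //; lra.
    have gx : g t <= g x by apply: gm; exact: ltW.
    have gy : g y <= g s by exact: gm.
    rewrite /c -mulrA; apply: ler_pM; [lra|by rewrite mulr_ge0 // divr_ge0 //; lra|lra|].
    have -> : e / (1 + e) * g x = g x - g x / (1 + e) by field; lra.
    suff : g y <= g x / (1 + e) by lra.
    by rewrite ler_pdivlMr; [nra|lra].
apply: (@le_trans _ _ (c * (3 / 4) * (p * (8 * q)^-1) / 2 * fine (P (beats u beta i)))).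
  by rewrite /gap_const.
rewrite -(@ler_pM2l _ 2) //; apply: le_trans cov_low.
have -> : 2 * (c * (3 / 4) * (p * (8 * q)^-1) / 2 * fine (P (beats u beta i))) =
   c * (3 / 4) * (p * (8 * q)^-1) * fine (P (beats u beta i)) by field; rewrite gt_eqF.
apply: ler_wpM2r; first exact: ltW.
apply: ler_pM => //.
- by rewrite mulr_ge0 // ltW.
- by rewrite mulr_ge0 // ltW.
- by rewrite ler_wpM2l //; [exact: ltW|lra].
Qed.

(** A larger value of [u i] only makes it harder for [j] to win, so the slice probability is
    nonincreasing and its covariance with [clamp] is nonpositive. *)
Lemma other_gap i j : j != i -> 0 < fine (P (beats u beta j)) ->
  cond_expectation (u i) (beats u beta j) <= \int[mu i]_x clamp x.
Proof.
move=> ji Pj; have mS : measurable (other_win u beta i j) by exact: measurable_other_win.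
have [-> _] := cond_slice indep slope mS (other_winE u beta i j)
  (measurable_beats u beta j) Pj.
rewrite gerDl; apply: mulr_le0_ge0; last by rewrite invr_ge0 ltW.
apply: cov_le0.
- exact: bounded_measurable_clamp.
- by apply: bounded_measurable_slice_prob => //; exact: cylinders_measurable.
have hm x y : x <= y -> slice_prob (P := P) (other_win u beta i j) y <=
    slice_prob (P := P) (other_win u beta i j) x.
  move=> xy; have ms z := slice_measurable (@cylinders_measurable _ _ _ _ _ u i) z mS.
  rewrite /slice_prob -lee_fin -!probability_fineK //.
  apply: le_measure; rewrite ?inE // => w /= [hi hk]; split => //.
  by apply: le_trans hi; rewrite ler_pM2l.
move=> x y; have [xy|/ltW yx] := leP x y.
  by rewrite mulr_le0_ge0 // ?subr_le0 ?subr_ge0 ?clamp_homo ?hm.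
by rewrite mulr_ge0_le0 // ?subr_le0 ?subr_ge0 ?clamp_homo ?hm.
Qed.

End Gap.

(** * The uniform gap *)

Theorem proposition6 (R : realType) (p q : R) (hp : 0 < p) (hpq : p < q) :
  exists C : R, 0 < C <= 1 /\
    forall (n : nat) (D : 'I_n -> probability (measurableTypeR R) R),
      (forall k, D k `[0%R, 1%R]%classic = 1%E) ->
      (forall k, pdf_bounded p q (D k)) ->
      (forall k, interval_support (D k)) ->
    forall (d : measure_display) (T : measurableType d) (P : probability T R)
      (u : 'I_n -> {RV P >-> R}),
      mutually_independent u ->
      (forall k, has_law (u k) (D k)) ->
    forall beta : 'I_n -> R,
      (forall k, 0 < beta k) ->
      (forall i, `|max_prob u beta i - 1 / n%:R| < 1 / (2 * n%:R)) ->
    forall i j : 'I_n, i != j ->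
      C <= cond_expectation (u i) (max_event u beta i)
           - cond_expectation (u i) (max_event u beta j).
Proof.
have q_gt0 : 0 < q by exact: lt_trans hp hpq.
have gap0 : 0 < gap_const p q.
  rewrite /gap_const; repeat (apply: mulr_gt0 || apply: divr_gt0 || apply: addr_gt0
    || apply: exprn_gt0 || rewrite invr_gt0 || done).
exists (Num.min 1 (gap_const p q)); split.
  by rewrite lt_min ltr01 gap0 ge_min lexx.
move=> n D _ pdf supp d T P u indep law beta beta_gt0 win i j ij.
have /choice[ab slope] : forall k, exists ab : R * R,
    cdf_slope p q ab.1 ab.2 (rv_cdf (u k)).
  move=> k; have [a [b sl]] := pdf_bounded_cdf_slope hp (pdf k) (supp k).
  exists (a, b); congr cdf_slope: sl; apply/funext => x.
  by rewrite /law_cdf /rv_cdf -law.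
(* Two distinct indices force at least two agents; this is what brings the winning probabilities
   below 3/4. *)
have n2 : 2 <= n%:R :> R.
  rewrite ler_nat ltnNge; apply/negP => n1; move/eqP: ij; apply.
  apply/val_inj => /=; have := ltn_ord i; have := ltn_ord j.
  by case: n n1 i j {D pdf supp u indep law beta beta_gt0 win ab slope} => [|[]] // _ [[]// ?] [[]// ?].
(* The window around [1 / n] runs from one to three times its half-width, whence the ratio 3 between
   any two winning probabilities. *)
have prob k : 1 / (2 * n%:R) < fine (P (beats u beta k)) < 3 * (1 / (2 * n%:R)).
  have := win k; rewrite /max_prob max_eventE ltr_norml.
  have -> : 1 / n%:R = 2 * (1 / (2 * n%:R)) :> R by field; lra.
  lra.
have n0 : 0 < 1 / (2 * n%:R) :> R by rewrite divr_gt0 // mulr_gt0 //; lra.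
have n4 : 1 / (2 * n%:R) <= 1 / 4 :> R.
  by rewrite ler_pdivrMr ?mulr_gt0 //; lra.
rewrite !max_eventE ge_min; apply/orP; right.
have gi : gap_const p q + \int[distribution P (u i)]_x clamp x <=
    cond_expectation (u i) (beats u beta i).
  apply: (own_gap indep beta_gt0 hp q_gt0 slope) => [||k _].
  - by have := prob i; lra.
  - by have := prob i; lra.
  - by have := prob i; have := prob k; lra.
have gj : cond_expectation (u i) (beats u beta j) <=
    \int[distribution P (u i)]_x clamp x.
  apply: (other_gap indep beta_gt0 slope); first by rewrite eq_sym.
  by have := prob j; lra.
lra.
Qed.
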